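(* Let $k$ be a field of characteristic $p>0$, $G$ a finite group and $A$ a commutative $k$-algebra on which $G$ acts faithfully by $k$-algebra automorphisms. Then: (1) $A^G\le A_{\rm soc}\le A^{{\rm O}_p(G)}=A_{{\rm soc}|_{{\rm O}_{p,p'}(G)}}$. (2) If $A$ is a domain with $\mathbb K:=\mathrm{Quot}(A)$, then $\mathrm{Quot}(A_{\rm soc})=\mathbb K_{\rm soc}=\mathbb K^G[\mathrm{Soc}(A)]$. (3) If $A$ is a normal domain, then $A^{{\rm O}_p(G)}$ is the integral closure of $A_{\rm soc}$ in its quotient field $\mathrm{Quot}(A_{\rm soc})$.
   Context: For a commutative $k$-algebra $A$ with $G$-action, $\mathrm{Soc}(A)$ is the socle of $A$ as a $kG$-module (the sum of all simple $kG$-submodules), and $A_{\rm soc}:=k[\mathrm{Soc}(A)]$ is the $k$-subalgebra of $A$ generated by $\mathrm{Soc}(A)$. For a subgroup $X\le G$, $A_{{\rm soc}|_X}$ is the $k$-subalgebra generated by the socle of $A$ regarded as a $kX$-module. $\mathbb K_{\rm soc}$ is defined in the same way for $\mathbb K$ with the induced $G$-action, as $k$-algebra with $G$-action. $A^X$ denotes the $X$-invariants. ${\rm O}_p(G)$ is the largest normal $p$-subgroup of $G$, and ${\rm O}_{p,p'}(G)$ is the preimage in $G$ of the largest normal subgroup of order coprime to $p$ of $G/{\rm O}_p(G)$. *)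

(* Defs.v *)
From HB Require Import structures.
From mathcomp Require Import all_boot all_order all_algebra all_fingroup.
From mathcomp Require Import all_solvable.
From mathcomp Require Export boolp classical_sets.

Set Implicit Arguments.
Unset Strict Implicit.
Unset Printing Implicit Defensive.

Import GRing.Theory.
Local Open Scope classical_set_scope.
Local Open Scope ring_scope.

#[short(type="fieldAlgType")]
HB.structure Definition FieldAlgebra (k : fieldType) :=
  {K of GRing.Field K & GRing.ComUnitAlgebra k K}.

Section Module.
Variables (k : fieldType) (gT : finGroupType) (G : {group gT}).
Variables (V : lmodType k) (to : action G V).
Implicit Types (X : {group gT}) (S : set V).

Definition submodule X S : Prop :=
  GRing.submod_closed [in S] /\
  (forall g v, g \in X -> v \in S -> to v g \in S).

Definition simple_submodule X S : Prop :=
  [/\ submodule X S, S <> [set 0]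
    & forall T : set V, submodule X T -> T `<=` S -> T = [set 0] \/ T = S].

Definition Soc X : set V :=
  [set v | exists2 s : seq V,
     forall x, x \in s -> exists2 S, simple_submodule X S & x \in S
     & v = \sum_(x <- s) x].

Definition invariants X : set V :=
  [set v | forall g, g \in X -> to v g = v].

End Module.

Section Algebra.
Variables (k : fieldType) (A : comAlgType k).

Definition subalg_gen (S : set A) : set A :=
  smallest (fun B : set A => GRing.subalg_closed [in B]) S.

Variables (gT : finGroupType) (G : {group gT}) (to : action G A).

(* Bijectivity is part of [action]. *)
Definition acts_by_alg_automorphisms : Prop :=
  forall g, g \in G -> linear (to^~ g) /\ monoid_morphism (to^~ g).

(* The library's [faithful] requires a finite carrier. *)
Definition acts_faithfully : Prop :=
  forall g, g \in G -> (forall a, to a g = a) -> g = 1%g.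

Definition soc_alg (X : {group gT}) : set A := subalg_gen (Soc to X).

End Algebra.

Section QuotientField.
Variables (k : fieldType) (A : comAlgType k) (K : fieldAlgType k).
Variable iota : {lrmorphism A -> K}.

Definition is_quotient_field : Prop :=
  injective iota /\
  (forall x : K, exists a b : A, b != 0 /\ x = iota a / iota b).

(* Meant for [iota] satisfying [is_quotient_field]. *)
Definition normal_domain : Prop :=
  forall x : K, integralOver iota x -> range iota x.

(* Determines [toK] uniquely when [is_quotient_field] holds:
   (a / b)^g = a^g / b^g. *)
Definition induced_action (gT : finGroupType) (G : {group gT})
    (to : action G A) (toK : action G K) : Prop :=
  acts_by_alg_automorphisms toK /\
  (forall g a, g \in G -> toK (iota a) g = iota (to a g)).

End QuotientField.

Section SubringsOfField.
Variable K : fieldType.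
Implicit Types R F S L : set K.

(* For R a subring of K, a copy of the quotient field of R inside K. *)
Definition Quot R : set K :=
  [set x | exists a b, [/\ a \in R, b \in R, b != 0 & x = a / b]].

(* F[S], the subring of K generated by F and S. *)
Definition adjoin F S : set K :=
  smallest (fun R => GRing.subring_closed [in R]) (F `|` S).

Definition integral_over R (x : K) : Prop :=
  exists p : {poly K}, [/\ p \is monic, forall i, p`_i \in R & root p x].

Definition integral_closure_in L R : set K :=
  [set x | x \in L /\ integral_over R x].

End SubringsOfField.

(* Main.v *)
(* A normal p-subgroup N acts trivially on every simple module, so A_soc lies in
   A^N; conversely, when X / N is a p'-group, Maschke's theorem applied to the
   cyclic X-modules inside A^N gives A^N <= Soc_X(A).

   In the fraction field, every element has a G-invariant denominator, so
   Soc(K) = K^G Soc(A), and K_soc is closed under inverses because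
   x^-1 = norm(x)^-1 * (product of the other conjugates of x).

   For the third part one needs Quot(A_soc) = K_soc = K^P with P = O_p(G).
   Averaging a functional over G and using independence of characters, every
   simple kG-module embeds in K; hence an element of G acting trivially on
   Soc(K) acts unipotently on every finite-dimensional module, so it has p-power
   order, and the pointwise stabilizer of K_soc is exactly P.  A trace argument
   with a separating combination then gives K^P <= K_soc, and integrality is
   read off the orbit polynomials. *)

Require Import Defs.
From HB Require Import structures.
From mathcomp Require Import all_boot all_order all_algebra all_fingroup.
From mathcomp Require Import all_solvable.
From mathcomp Require Import boolp classical_sets.
From mathcomp Require Import mxrepresentation ring.

Set Implicit Arguments.
Unset Strict Implicit.
Unset Printing Implicit Defensive.

Import GRing.Theory.
Local Open Scope classical_set_scope.
Local Open Scope ring_scope.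

(** * Closure conditions and subspaces of row vectors *)

Section Closedness.

Lemma submod_closedP (k : fieldType) (V : lmodType k) (S : set V) :
  GRing.submod_closed [in S] <->
  S 0 /\ forall a u v, S u -> S v -> S (a *: u + v).
Proof.
split=> -[S0 SL]; split; rewrite ?inE // in S0 *.
  by move=> a u v Su Sv; apply/set_mem/SL; apply/mem_set.
by move=> a u v /set_mem Su /set_mem Sv; apply/mem_set/SL.
Qed.

Lemma subalg_closedP (k : fieldType) (A : comAlgType k) (S : set A) :
  GRing.subalg_closed [in S] <->
  [/\ S 1, forall a u v, S u -> S v -> S (a *: u + v)
    & forall u v, S u -> S v -> S (u * v)].
Proof.
split=> -[S1 SL SM]; split; rewrite ?inE // in S1 *.
- by move=> a u v Su Sv; apply/set_mem/SL; apply/mem_set.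
- by move=> u v Su Sv; apply/set_mem/SM; apply/mem_set.
- by move=> a u v /set_mem Su /set_mem Sv; apply/mem_set/SL.
- by move=> u v /set_mem Su /set_mem Sv; apply/mem_set/SM.
Qed.

Lemma subring_closedP (R : nzRingType) (S : set R) :
  GRing.subring_closed [in S] <->
  [/\ S 1, forall u v, S u -> S v -> S (u - v)
    & forall u v, S u -> S v -> S (u * v)].
Proof.
split=> -[S1 SB SM]; split; rewrite ?inE // in S1 *.
- by move=> u v Su Sv; apply/set_mem/SB; apply/mem_set.
- by move=> u v Su Sv; apply/set_mem/SM; apply/mem_set.
- by move=> u v /set_mem Su /set_mem Sv; apply/mem_set/SB.
- by move=> u v /set_mem Su /set_mem Sv; apply/mem_set/SM.
Qed.

(* Row vectors form a finite-dimensional space: take a matrix of maximal rank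
   among those whose rows all lie in D. *)
Lemma submod_closed_rowspace (k : fieldType) n (D : set 'rV[k]_n) :
  GRing.submod_closed [in D] ->
  exists U : 'M[k]_n, forall v : 'rV_n, (v <= U)%MS <-> D v.
Proof.
move=> Dcl; have /submod_closedP[D0 DL] := Dcl.
pose Q r := `[< exists U : 'M[k]_n,
  (forall v : 'rV_n, (v <= U)%MS -> D v) /\ \rank U = r >].
have exQ : exists r, Q r.
  exists 0%N; apply/asboolP; exists 0; split; last exact: mxrank0.
  by move=> v; rewrite submx0 => /eqP->.
have Qn r : Q r -> (r <= n)%N by case/asboolP=> U [_ <-]; apply: rank_leq_row.
case: (ex_maxnP exQ Qn) => r /asboolP[U [UD rU]] rmax.
exists U => v; split=> [|Dv]; first exact: UD.
have sUUv : (U <= U + v)%MS by apply: addsmxSl.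
have UvD (w : 'rV_n) : (w <= U + v)%MS -> D w.
  case/sub_addsmxP=> -[x y] /= ->; rewrite addrC.
  rewrite [y]mx11_scalar mul_scalar_mx; apply: DL => //.
  by apply: UD; apply: submxMl.
have QUv : Q (\rank (U + v)%MS).
  by apply/asboolP; exists (U + v)%MS; split.
have := rmax _ QUv; rewrite -rU => rk.
apply: submx_trans (addsmxSr U v) _.
by rewrite -(mxrank_leqif_sup sUUv).2 eqn_leq rk mxrankS.
Qed.

End Closedness.

(** * Group actions on arbitrary types *)

(* The library states these facts for finite carriers only. *)
Section RawAction.
Variables (gT : finGroupType) (G : {group gT}) (T : Type) (to : action G T).

Lemma action_inj : left_injective to.
Proof. by case: to => ? []. Qed.

Lemma actionM (X : {group gT}) g h v : X \subset G -> g \in X -> h \in X ->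
  to v (g * h)%g = to (to v g) h.
Proof.
move=> /fintype.subsetP sXG Xg Xh; case: to => f [_ fM] /=.
by apply: fM; apply: sXG.
Qed.

Lemma action1 v : to v 1%g = v.
Proof.
by apply: (@action_inj 1%g); rewrite -(@actionM G) ?mulg1.
Qed.

(** Classical logic makes the fixing condition boolean, so the stabilizer becomes a [{group gT}] to
    which finite group theory applies. *)
Lemma pointwise_stabilizer (D : set T) :
  exists H : {group gT}, H \subset G /\
    forall g, g \in G -> (g \in H <-> forall v, D v -> to v g = v).
Proof.
pose H := [set g in G | `[< forall v, D v -> to v g = v >]]%SET.
have inH g : reflect (g \in G /\ forall v, D v -> to v g = v) (g \in H).
  rewrite inE; apply: (iffP andP) => -[Gg /asboolP]; first by split.
  by move=> Hg; split=> //; apply/asboolP.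
have gH : group_set H.
  apply/group_setP; split=> [|g h /inH[Gg Hg] /inH[Gh Hh]].
    by apply/inH; split=> // v _; apply: action1.
  apply/inH; split; first exact: groupM.
  by move=> v Dv; rewrite (actionM v (subxx G)) // Hg // Hh.
exists (Group gH); split; first by apply/fintype.subsetP=> g /inH[].
move=> g Gg; split; first by case/inH.
by move=> Hg; apply/inH.
Qed.

End RawAction.

(** * Submodules, socles and fixed points of linear actions *)

Section LinearAction.
Variables (k : fieldType) (gT : finGroupType) (G : {group gT}).
Variables (V : lmodType k) (to : action G V).
Hypothesis linto : forall g, g \in G -> linear (to^~ g).
Implicit Types (X Y N : {group gT}) (S : set V).

Lemma lact_linear a g : g \in G -> forall u v, to (a *: u + v) g = a *: to u g + to v g.
Proof. by move=> Gg u v; apply: linto. Qed.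

Lemma lactD g : g \in G -> forall u v, to (u + v) g = to u g + to v g.
Proof. by move=> Gg u v; have := lact_linear 1 Gg u v; rewrite !scale1r. Qed.

Lemma lact0 g : g \in G -> to 0 g = 0.
Proof. by move=> Gg; apply: (@addrI _ (to 0 g)); rewrite -lactD // !addr0. Qed.

Lemma lactZ a g : g \in G -> forall u, to (a *: u) g = a *: to u g.
Proof. by move=> Gg u; rewrite -[a *: u]addr0 lact_linear // lact0 // addr0. Qed.

Lemma lactB g : g \in G -> forall u v, to (u - v) g = to u g - to v g.
Proof. by move=> Gg u v; rewrite lactD // -scaleN1r lactZ // scaleN1r. Qed.

Lemma lact_sum g (I : Type) (r : seq I) (P : pred I) (F : I -> V) :
  g \in G -> to (\sum_(i <- r | P i) F i) g = \sum_(i <- r | P i) to (F i) g.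
Proof.
move=> Gg; apply: (big_morph (to^~ g)); [exact: lactD | exact: lact0].
Qed.

Lemma mem_subgroup X Y (g : gT) : X \subset Y -> g \in X -> g \in Y.
Proof. by move=> /fintype.subsetP; apply. Qed.

Lemma submoduleP X S : submodule to X S <->
  [/\ S 0, forall a u v, S u -> S v -> S (a *: u + v)
    & forall g v, g \in X -> S v -> S (to v g)].
Proof.
split=> [[/submod_closedP[S0 SL] SX]|[S0 SL SX]]; split=> //.
- by move=> g v Xg Sv; apply/set_mem/SX => //; apply/mem_set.
- by apply/submod_closedP.
- by move=> g v Xg /set_mem Sv; apply/mem_set/SX.
Qed.

(** If x lies in X and g in N, then x g = (x g x^-1) x, and the conjugate lies in N by normality; so
    N still fixes the translate by x of a fixed vector. *)
Lemma submodule_inv X N : X \subset G -> (N <| X)%g ->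
  submodule to X (invariants to N).
Proof.
move=> sXG /andP[sNX nNX]; have sNG := fintype.subset_trans sNX sXG.
have inG g : g \in N -> g \in G by exact: mem_subgroup.
apply/submoduleP; split=> [g Ng|a u v Nu Nv g Ng|x v Xx Nv g Ng].
- by rewrite lact0 // inG.
- by rewrite lact_linear ?inG // Nu // Nv.
have Xg := fintype.subsetP sNX _ Ng.
have Ngx : (g ^ x^-1)%g \in N by rewrite memJ_norm // groupV (fintype.subsetP nNX).
rewrite -(actionM to _ sXG) // conjgCV (actionM to _ sXG) ?(Nv _ Ngx) //.
exact: mem_subgroup sNX Ngx.
Qed.

(** Spreads a property from one nonzero vector to a whole simple module, with [T] the vectors that
    have it. *)
Lemma simple_eq X S T : simple_submodule to X S -> submodule to X T ->
  T `<=` S -> (exists2 v, T v & v != 0) -> S `<=` T.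
Proof.
move=> [_ _ Smin] modT sTS [v Tv nz_v]; case: (Smin T modT sTS) => [T0|-> //].
by move: Tv nz_v; rewrite T0 /= => ->; rewrite eqxx.
Qed.

Lemma simple_nz X S : simple_submodule to X S -> exists2 v, S v & v != 0.
Proof.
move=> [/submoduleP[S0 _ _] nzS _]; apply: contrapT => noS; apply: nzS.
apply/seteqP; split=> [v Sv|v /= ->//]; apply: contrapT => /eqP nz_v.
by apply: noS; exists v.
Qed.

Lemma simple_sub_Soc X S : simple_submodule to X S -> S `<=` Soc to X.
Proof.
move=> simS v Sv; exists [:: v]; last by rewrite big_seq1.
by move=> x; rewrite inE => /eqP->; exists S => //; apply/mem_set.
Qed.

Lemma Soc_ind X (Q : set V) :
  Q 0 -> (forall u v, Q u -> Q v -> Q (u + v)) ->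
  (forall S, simple_submodule to X S -> S `<=` Q) -> Soc to X `<=` Q.
Proof.
move=> Q0 QD QS v [s Ps ->]; rewrite big_seq; apply: big_ind => // x.
by move/Ps=> [S /QS sSQ /set_mem]; apply: sSQ.
Qed.

Lemma SocD X u v : Soc to X u -> Soc to X v -> Soc to X (u + v).
Proof.
move=> [s Ps ->] [t Pt ->]; exists (s ++ t); last by rewrite big_cat.
by move=> x; rewrite mem_cat => /orP[/Ps|/Pt].
Qed.

Lemma submodule_Soc X : X \subset G -> submodule to X (Soc to X).
Proof.
have S0 X0 : Soc to X0 0 by exists [::]; rewrite ?big_nil.
move=> sXG.
apply/submoduleP; split=> // [a u v Su Sv|g v Xg].
  apply: SocD => //; move: u Su; apply: Soc_ind => [|u w|S simS u Su].
  - by rewrite /= scaler0.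
  - by rewrite /= scalerDr; apply: SocD.
  apply: (simple_sub_Soc simS).
  case: simS => /submoduleP[S0' SL _] _ _.
  by rewrite -[_ *: _]addr0; apply: SL.
have Gg := mem_subgroup sXG Xg.
move: v; apply: Soc_ind => [|u w|S simS u Su].
- by rewrite /= lact0.
- by rewrite /= lactD //; apply: SocD.
apply: (simple_sub_Soc simS).
by case: simS => /submoduleP[_ _ SX] _ _; apply: SX.
Qed.

(** A nonzero fixed vector spans a line, which is a simple module. *)
Lemma inv_sub_Soc X : X \subset G -> invariants to X `<=` Soc to X.
Proof.
move=> sXG v Xv; have [->|nz_v] := eqVneq v 0.
  by case: (submodule_Soc sXG) => /submod_closedP[].
pose S := [set w | exists a : k, w = a *: v].
have modS : submodule to X S.
  apply/submoduleP; split=> [|a _ _ [b ->] [c ->]|g _ Xg [a ->]].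
  - by exists 0; rewrite scale0r.
  - by exists (a * b + c); rewrite scalerDl scalerA.
  by exists a; rewrite lactZ ?(mem_subgroup sXG) // Xv.
apply: (@simple_sub_Soc X S); last by exists 1; rewrite scale1r.
split=> // [S0|T modT sTS].
  have: S v by exists 1; rewrite scale1r.
  by rewrite S0 /= => v0; rewrite v0 eqxx in nz_v.
have [T0|nzT] := pselect (T `<=` [set 0]); [left|right]; apply/seteqP; split=> //.
  by case/submoduleP: modT => T0' _ _ _ ->.
case/submoduleP: modT => T0 TL _ _ [b ->].
have [w /not_implyP[Tw /= nz_w]] : exists w, ~ (T w -> [set 0] w).
  by apply/existsNP.
have [a wE] := sTS w Tw.
have nz_a : a != 0 by apply/eqP=> a0; apply: nz_w; rewrite wE a0 scale0r.
have -> : b *: v = (b / a) *: w + 0.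
  by rewrite wE scalerA divfK // addr0.
exact: TL.
Qed.

(** The n-th power of the operator x - 1 is the polynomial (X - 1)^n evaluated at x, so binomial
    identities can be applied in k[X] instead of among endomorphisms of V. *)
Lemma iter_act_poly (x : gT) v n : x \in G ->
  iter n (fun w => to w x - w) v =
  \sum_(i < n.+1) (('X - 1 : {poly k}) ^+ n)`_i *: to v (x ^+ i)%g.
Proof.
move=> Gx; pose e m (q : {poly k}) := \sum_(i < m) q`_i *: to v (x ^+ i)%g.
have eX m q : to (e m q) x = e m.+1 ('X * q).
  rewrite /e lact_sum // big_ord_recl /= coefXM scale0r add0r.
  apply: eq_bigr => i _; rewrite coefXM /= lactZ // -(actionM to _ (subxx G)) ?groupX //.
  by rewrite -expgSr.
elim: n => [|n IHn] /=; first by rewrite big_ord1 expr0 coef1 scale1r action1.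
rewrite IHn -/(e _ _) eX -/(e _ _) exprS mulrBl mul1r.
(* The coefficient of degree n + 1 of (X - 1)^n vanishes, so both sums can run over the same
   range. *)
have -> : e n.+1 (('X - 1) ^+ n) = e n.+2 (('X - 1) ^+ n).
  have := size_exp_XsubC n (1 : k); rewrite polyC1 => sz.
  by rewrite /e [RHS]big_ord_recr /= [_`_n.+1]nth_default ?sz // scale0r addr0.
by rewrite /e -sumrB; apply: eq_bigr => i _; rewrite coefB scalerBl.
Qed.

(* The operator x - 1 is nilpotent for x of p-power order, and it preserves the
   H-fixed points of S when x normalises H; so H can be enlarged by x as long
   as H is properly contained in N. *)
Lemma pgroup_fixpoint (p : nat) X N S :
    p \in [pchar k] -> X \subset G -> N \subset X -> (p.-group N)%g ->
    submodule to X S -> (exists2 v, S v & v != 0) ->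
  exists v, [/\ S v, v != 0 & invariants to N v].
Proof.
move=> pk sXG sNX pN /submoduleP[S0 SL SX] [v0 Sv0 nz_v0].
have sNG := fintype.subset_trans sNX sXG.
pose Q r := `[< exists H : {group gT}, [/\ H \subset N, #|H| = r
  & exists v, [/\ S v, v != 0 & invariants to H v]] >].
have exQ : exists r, Q r.
  exists 1%N; apply/asboolP; exists 1%G; rewrite sub1G cards1; split=> //.
  exists v0; split=> // g /set1P->; exact: action1.
have Qn r : Q r -> (r <= #|N|)%N.
  by case/asboolP=> H [sHN <- _]; apply: subset_leq_card.
case: (ex_maxnP exQ Qn) => r /asboolP[H [sHN rH [v [Sv nz_v Hv]]]] rmax.
have [eqHN|ltHN] := eqVproper sHN.
  by exists v; split=> // g; rewrite -eqHN; apply: Hv.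
have /properP[_ [x]] := nilpotent_proper_norm (pgroup_nil pN) ltHN.
case/setIP=> Nx nHx notHx.
have Xx := fintype.subsetP sNX x Nx; have Gx := fintype.subsetP sXG x Xx.
pose D w := to w x - w.
have pq : [pchar {poly k}].-nat #|N|.
  apply: sub_in_pnat pN => q _; rewrite inE => /eqP->.
  by rewrite pchar_poly.
(* As #|N| is a power of the characteristic, (X - 1)^#|N| = X^#|N| - 1, and x^#|N| = 1. *)
have Dn : iter #|N| D v = 0.
  rewrite (iter_act_poly v #|N| Gx) exprDn_pchar // exprNn_pchar // expr1n.
  have sumX j : (j < #|N|.+1)%N ->
      \sum_(i < #|N|.+1) ('X^j : {poly k})`_i *: to v (x ^+ i)%g
        = to v (x ^+ j)%g.
    move=> ltj; rewrite (bigD1 (Ordinal ltj)) //= coefXn eqxx scale1r big1 ?addr0 //.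
    by move=> i; rewrite -val_eqE /= coefXn => /negPf->; rewrite scale0r.
  under eq_bigr do rewrite coefB scalerBl.
  have sum1 := sumX 0%N isT; rewrite expr0 in sum1.
  by rewrite sumrB sumX // sum1 expg_cardG // expg0 subrr.
have exi : exists i, iter i D v == 0 by exists #|N|; rewrite Dn.
case: (ex_minnP exi) => -[|i] /= Di0 imin.
  by rewrite Di0 in nz_v.
(* The last nonzero iterate is killed by x - 1, hence fixed by x. *)
pose w := iter i D v.
have nz_w : w != 0 by apply/negP=> /imin; rewrite ltnn.
have fix_x : to w x = w by apply/eqP; rewrite -subr_eq0.
have [Sw Hw] : S w /\ invariants to H w.
  rewrite /w; elim: i {imin w nz_w fix_x Di0} => //= i [Sw Hw]; split.
    by rewrite /D -scaleN1r addrC; apply: SL => //; apply: SX.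
  move=> g Hg; have Gg := mem_subgroup sNG (mem_subgroup sHN Hg).
  rewrite /D lactB // (Hw _ Hg) -(actionM to _ (subxx G)) // conjgCV.
  have Hgx : (g ^ x^-1)%g \in H by rewrite memJ_norm // groupV.
  rewrite (actionM to _ (subxx G)) ?(Hw _ Hgx) //.
  exact: mem_subgroup sNG (mem_subgroup sHN Hgx).
have [Z [sZG ZP]] := pointwise_stabilizer to [set w].
have sHZ : (H <*> <[x]> \subset Z)%g.
  rewrite join_subG cycle_subG; apply/andP; split.
    apply/fintype.subsetP=> g Hg; apply/ZP.
      exact: mem_subgroup sNG (mem_subgroup sHN Hg).
    by move=> _ ->; apply: Hw.
  by apply/ZP=> // _ ->.
have sHxN : (H <*> <[x]> \subset N)%g by rewrite join_subG sHN cycle_subG.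
have: Q #|(H <*> <[x]>)%G|.
  apply/asboolP; exists (H <*> <[x]>)%G; split=> //; exists w; split=> // g Hxg.
  apply: (ZP _ _).1 => //; last exact: mem_subgroup sHZ Hxg.
  exact: mem_subgroup sNG (mem_subgroup sHxN Hxg).
move/rmax; rewrite -rH => le_card; case/negP: notHx.
have /eqP-> : H :==: (H <*> <[x]>)%G by rewrite eqEcard joing_subl le_card.
by rewrite /= -cycle_subG joing_subr.
Qed.

(** In a simple module the N-fixed vectors form a submodule because N is normal, and a nonzero one
    because N is a p-group in characteristic p; simplicity makes it everything. *)
Lemma Soc_sub_inv (p : nat) X N :
    p \in [pchar k] -> X \subset G -> (N <| X)%g -> (p.-group N)%g ->
  Soc to X `<=` invariants to N.
Proof.
move=> pk sXG nsNX pN; have sNX := normal_sub nsNX.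
have /submoduleP[N0 NL NX] := submodule_inv sXG nsNX.
apply: Soc_ind => // [u v Nu Nv|S simS].
  by rewrite -[u]scale1r; apply: NL.
have [modS _ _] := simS; have /submoduleP[S0 SL SX] := modS.
have [v [Sv nz_v Nv]] := pgroup_fixpoint pk sXG sNX pN modS (simple_nz simS).
suff sSN : S `<=` S `&` invariants to N by move=> u /sSN[].
apply: (simple_eq simS); last by exists v.
  apply/submoduleP; split=> // [a u w [? ?] [? ?]|g w Xg [? ?]].
    by split; [apply: SL | apply: NL].
  by split; [apply: SX | apply: NX].
by move=> ? [].
Qed.

End LinearAction.

(** * Simple modules under injective equivariant maps *)

Section EquivariantMap.
Variables (k : fieldType) (gT : finGroupType) (G X : {group gT}).
Variables (V W : lmodType k) (toV : action G V) (toW : action G W).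
Variable f : V -> W.
Hypotheses (linf : linear f) (injf : injective f).
Hypothesis equivf : forall g v, g \in X -> f (toV v g) = toW (f v) g.

Let f0 : f 0 = 0.
Proof. by have := linf (-1) 0 0; rewrite scaler0 addr0 scaleN1r addNr. Qed.

Lemma submodule_image S : submodule toV X S -> submodule toW X (f @` S).
Proof.
move=> /submoduleP[S0 SL SX].
apply/submoduleP; split=> [|a _ _ [u Su <-] [v Sv <-]|g _ Xg [v Sv <-]].
- by exists 0.
- by exists (a *: u + v); [apply: SL | rewrite linf].
- by exists (toV v g); [apply: SX | rewrite equivf].
Qed.

Lemma submodule_preimage S : submodule toW X S -> submodule toV X (f @^-1` S).
Proof.
move=> /submoduleP[S0 SL SX]; apply/submoduleP; split=> [|a u v Su Sv|g v Xg Sv].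
- by rewrite /preimage /= f0.
- by rewrite /preimage /= linf; apply: SL.
- by rewrite /preimage /= equivf //; apply: SX.
Qed.

Lemma simple_image S : simple_submodule toV X S -> simple_submodule toW X (f @` S).
Proof.
move=> simS; have [modS nzS minS] := simS; split; first exact: submodule_image.
  have [v Sv nz_v] := simple_nz simS.
  move=> S0; have: (f @` S) (f v) by exists v.
  by rewrite S0 /= -f0 => /injf v0; rewrite v0 eqxx in nz_v.
move=> T modT sTS.
have TE : T = f @` (f @^-1` T).
  apply/seteqP; split=> [_ /[dup] /sTS[v Sv <-]|_ [v Tv <-]//]; by exists v.
have sTS' : f @^-1` T `<=` S by move=> v /sTS[u Su /injf <-].
case: (minS _ (submodule_preimage modT) sTS') => T'E; [left|right].
  by rewrite TE T'E image_set1 f0.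
by rewrite TE T'E.
Qed.

Lemma simple_preimage S : simple_submodule toW X S -> S `<=` range f ->
  simple_submodule toV X (f @^-1` S).
Proof.
move=> simS Sf; have [modS nzS minS] := simS.
split; first exact: submodule_preimage.
  have [w Sw nz_w] := simple_nz simS; have [v _ vE] := Sf w Sw.
  move=> S0; have: (f @^-1` S) v by rewrite /preimage /= vE.
  by rewrite S0 /= => v0; rewrite -vE v0 f0 eqxx in nz_w.
move=> T modT sTS.
have sTS' : f @` T `<=` S by move=> _ [v /sTS ? <-].
case: (minS _ (submodule_image modT) sTS') => T'E; [left|right].
  apply/seteqP; split=> [v Tv|_ ->]; last by case/submoduleP: modT.
  apply: injf; rewrite f0; have: (f @` T) (f v) by exists v.
  by rewrite T'E.
apply/seteqP; split=> // v; rewrite -T'E => -[u Tu /injf <-] //.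
Qed.

End EquivariantMap.

(** * From matrix representations to the socle *)

Section MatrixRepresentation.
Variables (k : fieldType) (gT : finGroupType) (G X : {group gT}).
Variables (V : lmodType k) (to : action G V).
Hypotheses (sXG : X \subset G) (linto : forall g, g \in G -> linear (to^~ g)).
Variables (hT : finGroupType) (H : {group hT}) (n : nat).
Variables (rH : mx_representation k H n) (q : gT -> hT) (phi : 'rV[k]_n -> V).
Hypothesis qX : forall g, g \in X -> q g \in H.
Hypothesis q_onto : forall h, h \in H -> exists2 g, g \in X & q g = h.
Hypothesis linphi : linear phi.
Hypothesis equivphi :
  forall g v, g \in X -> phi (v *m rH (q g)) = to (phi v) g.

(** As [phi] vanishes on [U] and no submodule lies strictly between [U] and [W], the image of [W] is
    zero or simple. The map [q] allows the represented group to be a quotient of X as well as X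
    itself. *)
Lemma minimal_module_Soc (U W : 'M[k]_n) :
    mxmodule rH W -> (forall v : 'rV_n, (v <= U)%MS -> phi v = 0) -> (U <= W)%MS ->
    (forall M : 'M_n, mxmodule rH M -> (U <= M)%MS -> (M <= W)%MS ->
       (M <= U)%MS \/ (W <= M)%MS) ->
  forall v : 'rV_n, (v <= W)%MS -> Soc to X (phi v).
Proof.
move=> modW phiU sUW minW v sv.
have phi0 : phi 0 = 0 by apply: phiU; rewrite sub0mx.
pose S := [set w | exists2 u : 'rV_n, (u <= W)%MS & phi u = w].
have [S0|nzS] := pselect (S `<=` [set 0]).
  have -> : phi v = 0 by apply: S0; exists v.
  by have /submoduleP[] := submodule_Soc linto sXG.
have modS : submodule to X S.
  apply/submoduleP; split=> [|a _ _ [u Wu <-] [w Ww <-]|g _ Xg [u Wu <-]].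
  - by exists 0 => //; apply: sub0mx.
  - by exists (a *: u + w); rewrite ?linphi // addmx_sub ?scalemx_sub.
  exists (u *m rH (q g)); last by rewrite equivphi.
  by apply: submx_trans (submxMr _ Wu) _; apply: (mxmoduleP modW); apply: qX.
apply: (@simple_sub_Soc _ _ _ _ _ X S); last by exists v.
split=> // [S0|T modT sTS]; first by apply: nzS; rewrite S0.
have /submoduleP[T0 TL TX] := modT.
(* The preimage of [T] in [W] is the row space of a matrix [M] between [U] and [W], to which
   minimality applies. *)
pose D := [set u : 'rV[k]_n | (u <= W)%MS /\ T (phi u)].
have [M MD] : exists M : 'M[k]_n, forall u : 'rV_n, (u <= M)%MS <-> D u.
  apply: submod_closed_rowspace; apply/submod_closedP; split.
    by split; rewrite ?sub0mx ?phi0.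
  move=> a u w [Wu Tu] [Ww Tw]; split; first by rewrite addmx_sub ?scalemx_sub.
  by rewrite linphi; apply: TL.
have rowM i : D (row i M) by apply/MD/row_sub.
have sMW : (M <= W)%MS by apply/row_subP=> i; case: (rowM i).
have sUM : (U <= M)%MS.
  apply/row_subP=> i; apply/MD; split; first exact: submx_trans (row_sub i U) sUW.
  by rewrite phiU ?row_sub.
have modM : mxmodule rH M.
  apply/mxmoduleP=> h Hh; have [g Xg <-] := q_onto Hh.
  apply/row_subP=> i; rewrite row_mul; apply/MD; have [Wi Ti] := rowM i.
  split; last by rewrite equivphi //; apply: TX.
  by apply: submx_trans (submxMr _ Wi) _; apply: (mxmoduleP modW); apply: qX.
case: (minW M modM sUM sMW) => [sMU|sWM]; [left|right]; apply/seteqP; split=> //.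
- move=> t Tt; have [u Wu uE] := sTS t Tt; rewrite -uE.
  by apply: phiU; apply: submx_trans sMU; apply/MD; split; rewrite ?uE.
- by move=> _ ->.
move=> _ [u Wu <-]; suff [] : D u by [].
by apply/MD; apply: submx_trans Wu sWM.
Qed.

End MatrixRepresentation.

(** * Maschke's theorem modulo a normal subgroup *)

Section Maschke.
Variables (k : fieldType) (gT : finGroupType) (G X N : {group gT}).
Variables (V : lmodType k) (to : action G V) (p : nat).
Hypotheses (sXG : X \subset G) (linto : forall g, g \in G -> linear (to^~ g)).
Hypotheses (pk : p \in [pchar k]) (nsNX : (N <| X)%g) (pX : (p^'.-group (X / N))%g).

(** Translates of an N-fixed v depend only on the coset, so the regular module of X / N maps onto
    the cyclic module generated by v. By Maschke the regular module is a sum of simple ones, and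
    their images lie in the socle. *)
Lemma inv_sub_Soc_Maschke : invariants to N `<=` Soc to X.
Proof.
move=> v Nv; set H := (X / N)%G; pose rH := regular_repr k H.
have nNX := normal_norm nsNX; have sNX := normal_sub nsNX.
pose phi (u : 'rV[k]_#|H|) := \sum_i u 0 i *: to v (repr (enum_val i)).
have linphi : linear phi.
  move=> a u w; rewrite /phi scaler_sumr -big_split; apply: eq_bigr => i _ /=.
  by rewrite !mxE scalerDl scalerA.
have phiD a b : phi (a + b) = phi a + phi b.
  by have := linphi 1 a b; rewrite !scale1r.
have phi0 : phi 0 = 0 by apply: (@addrI _ (phi 0)); rewrite -phiD !addr0.
have phi_delta i : phi (delta_mx 0 i) = to v (repr (enum_val i)).
  rewrite /phi (bigD1 i) //= mxE !eqxx scale1r big1 ?addr0 // => j /negPf nji.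
  by rewrite mxE nji andbF scale0r.
have reprX (c : coset_of N) : c \in H -> repr c \in X.
  case/morphimP=> x Nx Xx ->; rewrite /= val_coset //.
  have /rcosetP[y Ny ->] := mem_repr_rcoset N x.
  by rewrite groupM // (mem_subgroup sNX Ny).
have to_repr g : g \in X -> to v (repr (coset N g)) = to v g.
  move=> Xg; rewrite val_coset ?(fintype.subsetP nNX) //.
  have /rcosetP[y Ny ->] := mem_repr_rcoset N g.
  have Xy := mem_subgroup sNX Ny.
  by rewrite (actionM to v sXG Xy Xg) Nv.
have equivphi g u : g \in X -> phi (u *m rH (coset N g)) = to (phi u) g.
  move=> Xg; have Gg := mem_subgroup sXG Xg.
  rewrite [u in LHS]row_sum_delta mulmx_suml (big_morph phi phiD phi0).
  rewrite lact_sum //; apply: eq_bigr => i _.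
  rewrite -scalemxAl -[_ *: _]addr0 linphi phi0 addr0 lactZ //; congr (_ *: _).
  rewrite -rowE rowK phi_delta; have := enum_valP i; case/morphimP=> x Nx Xx ->.
  rewrite gring_indexK ?groupM ?mem_quotient // -morphM ?(fintype.subsetP nNX) //.
  by rewrite !to_repr ?groupM // -(actionM to v sXG).
have qX g : g \in X -> coset N g \in H by exact: mem_quotient.
have q_onto h : h \in H -> exists2 g, g \in X & coset N g = h.
  by case/morphimP=> x _ Xx ->; exists x.
have phi_Soc (u : 'rV_#|H|) : Soc to X (phi u).
  have pH : ([char k]^').-group%g H.
    by rewrite (eq_pgroup _ (eq_negn (pcharf_eq pk))).
  (* Semisimplicity is given under [classically], which can be used only for a boolean goal. *)
  apply/asboolP.
  apply: (mx_reducible_semisimple (mxmodule1 rH) (mx_Maschke_pchar rH pH)).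
  case=> I U W simU defW _; apply/asboolP.
  have /sub_sumsmxP[u_ ->] : (u <= \sum_i U i)%MS by rewrite defW submx1.
  apply: (@big_ind _ (fun w => Soc to X (phi w))).
  - by rewrite phi0; case: (submodule_Soc linto sXG) => /submod_closedP[].
  - by move=> a b; rewrite phiD; apply: SocD.
  move=> i _; have [modU nzU minU] := simU i.
  apply: (minimal_module_Soc sXG linto qX q_onto linphi equivphi modU (U := 0)).
  - by move=> w; rewrite submx0 => /eqP->.
  - exact: sub0mx.
  - move=> M modM _ sMU; have [->|nzM] := eqVneq M 0; first by left; apply: submx_refl.
    by right; apply: minU.
  exact: submxMl.
have -> : v = phi (delta_mx 0 (gring_index H 1%g)).
  by rewrite phi_delta gring_indexK // -(morph1 (coset N)) to_repr // (action1 to).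
exact: phi_Soc.
Qed.
End Maschke.

(** * Socle subalgebras and orbit norms *)

Section AlgebraAction.
Variables (k : fieldType) (gT : finGroupType) (G : {group gT}).
Variables (A : comAlgType k) (to : action G A).
Hypothesis hto : acts_by_alg_automorphisms to.
Implicit Types (X N : {group gT}).

Let linto g : g \in G -> linear (to^~ g).
Proof. by case/hto. Qed.

Lemma aact1 g : g \in G -> to 1 g = 1.
Proof. by case/hto=> _ []. Qed.

Lemma aactM g : g \in G -> forall u v, to (u * v) g = to u g * to v g.
Proof. by case/hto=> _ []. Qed.

Lemma aact_alg g a : g \in G -> to a%:A g = a%:A.
Proof. by move=> Gg; rewrite (lactZ linto) // aact1. Qed.

Lemma aact_prod g (I : Type) (r : seq I) (P : pred I) (F : I -> A) :
  g \in G -> to (\prod_(i <- r | P i) F i) g = \prod_(i <- r | P i) to (F i) g.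
Proof.
move=> Gg; apply: (big_morph (to^~ g)); [exact: aactM | exact: aact1].
Qed.

Lemma invariants_subalg X : X \subset G ->
  GRing.subalg_closed [in invariants to X].
Proof.
move=> sXG; apply/subalg_closedP; split=> [g Xg|a u v Xu Xv g Xg|u v Xu Xv g Xg].
all: have Gg := mem_subgroup sXG Xg.
- exact: aact1.
- by rewrite (lact_linear linto) // Xu // Xv.
- by rewrite aactM // Xu // Xv.
Qed.

Lemma soc_alg_closed X : GRing.subalg_closed [in soc_alg to X].
Proof.
apply/subalg_closedP; split=> [B [Bcl _]|a u v Su Sv B BP|u v Su Sv B BP].
- by case/subalg_closedP: Bcl.
- by have [/subalg_closedP[_ BL _] _] := BP; apply: BL; [apply: Su|apply: Sv].
- by have [/subalg_closedP[_ _ BM] _] := BP; apply: BM; [apply: Su|apply: Sv].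
Qed.

Lemma Soc_sub_soc_alg X : Soc to X `<=` soc_alg to X.
Proof. exact: sub_gen_smallest. Qed.

Lemma soc_alg_sub X (B : set A) :
  GRing.subalg_closed [in B] -> Soc to X `<=` B -> soc_alg to X `<=` B.
Proof. by move=> Bcl sB; apply: (@smallest_sub _ _ (Soc to X)). Qed.

(** The elements whose translate by g lies in the algebra form a subalgebra, which contains the
    socle. *)
Lemma soc_alg_act X g v : X \subset G -> g \in X ->
  soc_alg to X v -> soc_alg to X (to v g).
Proof.
move=> sXG Xg; have Gg := mem_subgroup sXG Xg; move: v.
have /subalg_closedP[S1 SL SM] := soc_alg_closed X.
apply: (@soc_alg_sub X [set v | soc_alg to X (to v g)]) => /=.
  apply/subalg_closedP; split=> [|a u v|u v] /=.
  - by rewrite aact1.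
  - by rewrite (lact_linear linto) // => ? ?; apply: SL.
  - by rewrite aactM // => ? ?; apply: SM.
move=> v Sv; apply: Soc_sub_soc_alg.
by case/submoduleP: (submodule_Soc linto sXG) => _ _; apply.
Qed.

Lemma inv_sub_soc_alg X : X \subset G -> invariants to X `<=` soc_alg to X.
Proof.
by move=> sXG v Xv; apply: Soc_sub_soc_alg; apply: (inv_sub_Soc linto sXG).
Qed.

Lemma soc_alg_sub_inv p X N : p \in [pchar k] -> X \subset G -> (N <| X)%g ->
  (p.-group N)%g -> soc_alg to X `<=` invariants to N.
Proof.
move=> pk sXG nsNX pN; apply: soc_alg_sub; last exact: (Soc_sub_inv linto pk).
by apply: invariants_subalg; apply: fintype.subset_trans (normal_sub nsNX) sXG.
Qed.

(** The quotient of ['O_{p, p^'}(G)] by ['O_p(G)] is a p'-group, so Maschke applies; the reverse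
    inclusion uses that ['O_p(G)] is a normal p-subgroup of it. *)
Lemma inv_pcore_eq_soc_alg p : p \in [pchar k] ->
  invariants to 'O_p(G)%G = soc_alg to 'O_{p, p^'}(G)%G.
Proof.
move=> pk; have sXG : ('O_{p, p^'}(G) \subset G)%g by apply: pseries_sub.
have nsNX : ('O_p(G) <| 'O_{p, p^'}(G))%g.
  apply: (normalS _ (pseries_sub _ _) (pcore_normal p G)).
  by rewrite /= -pseries1 (pseries_sub_catl [:: p : nat_pred] [:: (p^' : nat_pred)]).
apply/seteqP; split; last exact: (@soc_alg_sub_inv p _ _ pk sXG nsNX (pcore_pgroup p G)).
apply: subset_trans (@Soc_sub_soc_alg _).
apply: (inv_sub_Soc_Maschke sXG linto pk nsNX).
by rewrite /= quotient_pseries2 pcore_pgroup.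
Qed.

(** The product runs over the group, so points with a nontrivial stabilizer are repeated. *)
Definition orbit_norm b := \prod_(g in G) to b g.

Lemma orbit_norm_inv b : invariants to G (orbit_norm b).
Proof.
move=> h Gh; rewrite /orbit_norm aact_prod // [RHS](reindex_acts 'R _ Gh) ?astabsR //=.
by apply: eq_bigr => g Gg; rewrite (actionM to b (subxx G)).
Qed.

Lemma orbit_normE b : orbit_norm b = b * \prod_(g in G | g != 1%g) to b g.
Proof. by rewrite /orbit_norm (bigD1 1%g) //= (action1 to). Qed.

End AlgebraAction.

(** * Actions on a field and inverses *)

Section FieldAction.
Variables (k : fieldType) (gT : finGroupType) (G : {group gT}).
Variables (K : fieldAlgType k) (toK : action G K).
Hypothesis htoK : acts_by_alg_automorphisms toK.

Let linK g : g \in G -> linear (toK^~ g).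
Proof. by case/htoK. Qed.

Lemma field_act_eq0 g x : g \in G -> (toK x g == 0) = (x == 0).
Proof.
move=> Gg; apply/eqP/eqP=> [x0|->]; last exact: (lact0 linK).
by apply: (@action_inj _ _ _ toK g); rewrite x0 (lact0 linK).
Qed.

Lemma field_actV g x : g \in G -> toK x^-1 g = (toK x g)^-1.
Proof.
move=> Gg; have [->|nz_x] := eqVneq x 0; first by rewrite invr0 (lact0 linK) // invr0.
have nz_gx : toK x g != 0 by rewrite field_act_eq0.
by apply: (mulIf nz_gx); rewrite -aactM // !mulVf // aact1.
Qed.

Lemma invariantsV (X : {group gT}) x : X \subset G ->
  invariants toK X x -> invariants toK X x^-1.
Proof. by move=> sXG Xx g Xg; rewrite field_actV ?(mem_subgroup sXG) // Xx. Qed.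

Lemma orbit_norm_eq0 x : x != 0 -> orbit_norm toK x != 0.
Proof. by move=> nz_x; apply/prodf_neq0 => g Gg; rewrite field_act_eq0. Qed.

Lemma soc_algV x : soc_alg toK G x -> soc_alg toK G x^-1.
Proof.
move=> Lx; have [->|nz_x] := eqVneq x 0.
  by rewrite invr0; apply: (inv_sub_soc_alg htoK) => // g Gg; apply: (lact0 linK).
have /subalg_closedP[L1 _ LM] := soc_alg_closed toK G.
have -> : x^-1 = (orbit_norm toK x)^-1 * \prod_(g in G | g != 1%g) toK x g.
  have := orbit_norm_eq0 nz_x; rewrite orbit_normE mulf_eq0 negb_or => /andP[_ nz_y].
  by rewrite invfM mulfVK.
apply: (LM).
  apply: (inv_sub_soc_alg htoK) => //; apply: invariantsV => //.
  exact: (orbit_norm_inv htoK).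
apply: (@big_ind _ (soc_alg toK G)) => // g /andP[Gg _].
exact: (soc_alg_act htoK).
Qed.

(** Multiplication by a nonzero invariant is linear, injective and equivariant. *)
Lemma simple_scale (X : {group gT}) x S : X \subset G -> invariants toK X x -> x != 0 ->
  simple_submodule toK X S -> simple_submodule toK X ( *%R x @` S).
Proof.
move=> sXG Xx nz_x; apply: simple_image.
- by move=> a u w; rewrite mulrDr scalerAr.
- exact: mulfI.
- by move=> g v Xg; rewrite (aactM htoK) ?(mem_subgroup sXG) // Xx.
Qed.

End FieldAction.

(** * Subrings of a field and their quotient fields *)

Section Subrings.
Variable K : fieldType.

Lemma Quot_subring (R : set K) :
  GRing.subring_closed [in R] -> GRing.subring_closed [in Quot R].
Proof.
case/subring_closedP=> R1 RB RM; apply/subring_closedP; split.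
- by exists 1, 1; split; rewrite ?inE ?oner_eq0 ?divr1.
- move=> _ _ [a [b [/set_mem Ra /set_mem Rb nz_b ->]]]
         [c [d [/set_mem Rc /set_mem Rd nz_d ->]]].
  exists (a * d - c * b), (b * d); split; rewrite ?mulf_neq0 //.
  + by apply/mem_set; apply: RB; apply: RM.
  + by apply/mem_set; apply: RM.
  + by field; apply/andP.
- move=> _ _ [a [b [/set_mem Ra /set_mem Rb nz_b ->]]]
         [c [d [/set_mem Rc /set_mem Rd nz_d ->]]].
  exists (a * c), (b * d); split; rewrite ?mulf_neq0 //.
  + by apply/mem_set; apply: RM.
  + by apply/mem_set; apply: RM.
  + by field; apply/andP.
Qed.

Lemma sub_Quot (R : set K) : R 1 -> R `<=` Quot R.
Proof. by move=> R1 x Rx; exists x, 1; rewrite !inE oner_eq0 divr1. Qed.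

End Subrings.

Lemma subalg_image_subring (k : fieldType) (A B : comAlgType k)
    (f : {lrmorphism A -> B}) (R : set A) :
  GRing.subalg_closed [in R] -> GRing.subring_closed [in f @` R].
Proof.
case/subalg_closedP=> R1 RL RM; apply/subring_closedP; split.
- by exists 1; rewrite ?rmorph1.
- move=> _ _ [u Ru <-] [v Rv <-]; exists (u - v); rewrite ?rmorphB //.
  by rewrite addrC -scaleN1r; apply: RL.
- by move=> _ _ [u Ru <-] [v Rv <-]; exists (u * v); rewrite ?rmorphM //; apply: RM.
Qed.

(** * The socle algebra of the quotient field *)

Section QuotientField.
Variables (k : fieldType) (gT : finGroupType) (G : {group gT}).
Variables (A : comAlgType k) (to : action G A) (K : fieldAlgType k).
Variables (iota : {lrmorphism A -> K}) (toK : action G K).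
Hypotheses (hto : acts_by_alg_automorphisms to) (quoK : is_quotient_field iota).
Hypothesis htoK : induced_action iota to toK.

Let linA g : g \in G -> linear (to^~ g).
Proof. by case/hto. Qed.
Let actK : acts_by_alg_automorphisms toK.
Proof. by case: htoK. Qed.
Let linK g : g \in G -> linear (toK^~ g).
Proof. by case/actK. Qed.
Let inj_iota : injective iota.
Proof. by case: quoK. Qed.
Let iotaE g a : g \in G -> iota (to a g) = toK (iota a) g.
Proof. by case: htoK => _ toE Gg; rewrite toE. Qed.

Lemma iota_invariants (X : {group gT}) a : X \subset G ->
  invariants toK X (iota a) <-> invariants to X a.
Proof.
move=> sXG; split=> Xa g Xg; have Gg := mem_subgroup sXG Xg.
  by apply: inj_iota; rewrite iotaE // Xa.
by rewrite -iotaE // Xa.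
Qed.

Lemma iota_eq0 a : (iota a == 0) = (a == 0).
Proof. by rewrite -(rmorph0 iota) (inj_eq inj_iota). Qed.

Lemma iota_orbit_norm b : iota (orbit_norm to b) = orbit_norm toK (iota b).
Proof. by rewrite rmorph_prod; apply: eq_bigr => g Gg; apply: iotaE. Qed.

(** Expanding a / b by the remaining conjugates of b turns the denominator into the orbit norm of
    b. *)
Lemma quotient_field_denominator x :
  exists a b, [/\ invariants to G b, b != 0 & iota b * x = iota a].
Proof.
have [_ /(_ x)[a [b [nz_b ->]]]] := quoK.
exists (a * \prod_(g in G | g != 1%g) to b g), (orbit_norm to b).
have nz_ib : iota b != 0 by rewrite iota_eq0.
split; first exact: (orbit_norm_inv hto).
  by rewrite -iota_eq0 iota_orbit_norm (orbit_norm_eq0 actK).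
by rewrite orbit_normE !rmorphM /=; field.
Qed.

Lemma simple_iota (X : {group gT}) S : X \subset G -> simple_submodule to X S ->
  simple_submodule toK X (iota @` S).
Proof.
move=> sXG; apply: simple_image => //; first exact: linearP.
move=> g a Xg; apply: iotaE; exact: mem_subgroup sXG Xg.
Qed.

Lemma Soc_iota (X : {group gT}) : X \subset G -> iota @` Soc to X `<=` Soc toK X.
Proof.
move=> sXG _ [a Sa <-]; move: a Sa.
apply: (@Soc_ind _ _ _ _ to X [set a | Soc toK X (iota a)]) => /=.
- by rewrite rmorph0; case/submoduleP: (submodule_Soc linK sXG).
- by move=> u v; rewrite rmorphD; apply: SocD.
move=> S simS a Sa; apply: (simple_sub_Soc (simple_iota sXG simS)).
by exists a.
Qed.

Lemma soc_alg_iota : iota @` soc_alg to G `<=` soc_alg toK G.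
Proof.
move=> _ [a Sa <-]; move: a Sa.
have /subalg_closedP[L1 LL LM] := soc_alg_closed toK G.
apply: (@soc_alg_sub _ _ _ _ to G [set a | soc_alg toK G (iota a)]).
  apply/subalg_closedP; split=> [|a u v|u v] /=.
  - by rewrite rmorph1.
  - by rewrite linearP; apply: LL.
  - by rewrite rmorphM; apply: LM.
by move=> a Sa; apply: Soc_sub_soc_alg; apply: Soc_iota => //; exists a.
Qed.

(* By simplicity, an invariant denominator of one nonzero element of S clears
   all of S. *)
Lemma simple_clear_denominator S : simple_submodule toK G S ->
  exists b, [/\ invariants to G b, b != 0
    & forall x, S x -> exists2 a, Soc to G a & iota b * x = iota a].
Proof.
move=> simS; have [x0 Sx0 nz_x0] := simple_nz simS.
have [a0 [b [Gb nz_b a0E]]] := quotient_field_denominator x0.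
have nz_ib : iota b != 0 by rewrite iota_eq0.
have Gib : invariants toK G (iota b) by apply/iota_invariants.
have simbS := simple_scale actK (subxx G) Gib nz_ib simS.
have bSf : *%R (iota b) @` S `<=` range iota.
  suff bST : *%R (iota b) @` S `<=` ( *%R (iota b) @` S) `&` range iota.
    by move=> y /bST[].
  have [/submoduleP[S0 SL SX] _ _] := simbS.
  apply: (simple_eq simbS); last first.
  - exists (iota b * x0); last by rewrite mulf_neq0.
    by split; [exists x0 | exists a0].
  - by move=> y [].
  apply/submoduleP; split=> [|a y z [Sy [u _ uE]] [Sz [v _ vE]]|g y Gg [Sy [u _ uE]]].
  - by split=> //; exists 0; rewrite ?rmorph0.
  - by split; [apply: SL | exists (a *: u + v); rewrite // -uE -vE linearP].
  - by split; [apply: SX | exists (to u g); rewrite ?iotaE ?uE].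
have simA : simple_submodule to G (iota @^-1` ( *%R (iota b) @` S)).
  by apply: (simple_preimage _ inj_iota) simbS bSf => //; exact: linearP.
exists b; split=> // x Sx.
have [a _ aE] : range iota (iota b * x) by apply: bSf; exists x.
exists a => //; apply: (simple_sub_Soc simA).
by rewrite /preimage /= aE; exists x.
Qed.

Let L := soc_alg toK G.

Lemma adjoin_closed F S : GRing.subring_closed [in @adjoin K F S].
Proof.
apply/subring_closedP; split=> [B [Bcl _]|u v Su Sv B BP|u v Su Sv B BP].
- by case/subring_closedP: Bcl.
- by have [/subring_closedP[_ BL _] _] := BP; apply: BL; [apply: Su|apply: Sv].
- by have [/subring_closedP[_ _ BM] _] := BP; apply: BM; [apply: Su|apply: Sv].
Qed.

(** An invariant multiple of each simple submodule of K comes from Soc(A), so Soc(K) lies in K^G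
    Soc(A). Scalars of k are invariant, which makes the generated subring a subalgebra. *)
Lemma soc_alg_sub_adjoin : L `<=` adjoin (invariants toK G) (iota @` Soc to G).
Proof.
set B := adjoin _ _.
have /subring_closedP[B1 BB BM] : GRing.subring_closed [in B] := adjoin_closed _ _.
have B0 : B 0 by rewrite -(subrr 1); apply: BB.
have BD u v : B u -> B v -> B (u + v).
  by move=> Bu Bv; rewrite -[v]opprK; apply: (BB) => //; rewrite -sub0r; apply: BB.
have sinvB : invariants toK G `<=` B by apply: sub_smallest => x; left.
have sSocB : iota @` Soc to G `<=` B by apply: sub_smallest => x; right.
apply: soc_alg_sub.
  apply/subalg_closedP; split=> // a u v Bu Bv; apply: BD => //.
  rewrite -mulr_algl; apply: BM => //; apply: sinvB => g Gg.
  exact: (aact_alg actK).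
apply: Soc_ind => // S /simple_clear_denominator[b [Gb nz_b SE]] x /SE[a Sa aE].
have nz_ib : iota b != 0 by rewrite iota_eq0.
have -> : x = (iota b)^-1 * iota a by rewrite -aE mulKf.
apply: BM; last by apply: sSocB; exists a.
by apply: sinvB; apply: (invariantsV actK) => //; apply/iota_invariants.
Qed.

(** With an invariant denominator, the numerator of an invariant fraction is invariant too. *)
Lemma invariants_sub_Quot : invariants toK G `<=` Quot (iota @` soc_alg to G).
Proof.
move=> x Gx; have [a [b [Gb nz_b abE]]] := quotient_field_denominator x.
have nz_ib : iota b != 0 by rewrite iota_eq0.
have Ga : invariants to G a.
  by apply/iota_invariants=> // g Gg; rewrite -abE (aactM actK) // Gx // -iotaE // Gb.
exists (iota a), (iota b); split; rewrite // ?inE /=.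
- by exists a => //; apply: (inv_sub_soc_alg hto).
- by exists b => //; apply: (inv_sub_soc_alg hto).
- by rewrite -abE mulrC mulKf.
Qed.

Lemma adjoin_sub_Quot :
  adjoin (invariants toK G) (iota @` Soc to G) `<=` Quot (iota @` soc_alg to G).
Proof.
have Rcl := subalg_image_subring iota (soc_alg_closed to G).
have /subring_closedP[R1 _ _] := Rcl.
apply: smallest_sub; first exact: Quot_subring.
move=> x [Gx|[a Sa <-]]; first exact: invariants_sub_Quot.
by apply: sub_Quot => //; exists a => //; apply: Soc_sub_soc_alg.
Qed.

Lemma Quot_sub_soc_alg : Quot (iota @` soc_alg to G) `<=` L.
Proof.
move=> _ [a [b [/set_mem Ra /set_mem Rb _ ->]]].
have /subalg_closedP[_ _ LM] := soc_alg_closed toK G.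
by apply: LM; [|apply: (soc_algV actK)]; apply: soc_alg_iota.
Qed.

(** The inclusions form a cycle: [L] in the adjunction, the adjunction in [Quot], and [Quot] in
    [L]. *)
Lemma Quot_soc_alg : Quot (iota @` soc_alg to G) = L /\
  L = adjoin (invariants toK G) (iota @` Soc to G).
Proof.
have sLB := soc_alg_sub_adjoin; have sBQ := adjoin_sub_Quot.
have sQL := Quot_sub_soc_alg.
by split; apply/seteqP; split=> //; [apply: subset_trans sBQ | apply: subset_trans sQL].
Qed.

End QuotientField.

(** * Existence of the induced action on the quotient field *)

Section InducedAction.
Variables (k : fieldType) (gT : finGroupType) (G : {group gT}).
Variables (A : comAlgType k) (to : action G A) (K : fieldAlgType k).
Variable iota : {lrmorphism A -> K}.
Hypotheses (hto : acts_by_alg_automorphisms to) (quoK : is_quotient_field iota).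

Let linA g : g \in G -> linear (to^~ g).
Proof. by case/hto. Qed.

Lemma induced_action_exists : exists toK : action G K, induced_action iota to toK.
Proof.
have [inj_iota quo] := quoK.
have [num numP] := choice quo; have [den denP] := choice numP.
have i0 a : (iota a == 0) = (a == 0) by rewrite -(rmorph0 iota) (inj_eq inj_iota).
have iM a b : iota (a * b) = iota a * iota b by exact: rmorphM.
have iD a b : iota (a + b) = iota a + iota b by exact: rmorphD.
have nzM (a b : A) : a != 0 -> b != 0 -> a * b != 0.
  by rewrite -!i0 iM mulf_eq0 negb_or => -> ->.
have nz_den x : iota (den x) != 0 by rewrite i0; case: (denP x).
have nz_to a g : g \in G -> a != 0 -> iota (to a g) != 0.
  move=> Gg; rewrite i0; apply: contra => /eqP a0; apply/eqP.
  by apply: (@action_inj _ _ _ to g); rewrite a0 (lact0 linA).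
(* Elements outside G act as the identity because [is_action] asks for injectivity at every element
   of [gT]. *)
pose f x g := if g \in G then iota (to (num x) g) / iota (to (den x) g) else x.
(* Independence of the chosen numerator and denominator, by cross-multiplication in A. *)
have fE a b g : g \in G -> b != 0 ->
    f (iota a / iota b) g = iota (to a g) / iota (to b g).
  move=> Gg nz_b; rewrite /f Gg; set x := iota a / iota b.
  have [nz_d xE] := denP x; have nz_ib : iota b != 0 by rewrite i0.
  apply/eqP; rewrite eqr_div ?nz_to // -!iM -!aactM //; apply/eqP.
  congr (iota (to _ g)); apply: inj_iota; rewrite !iM.
  by move/eqP: xE; rewrite /x eqr_div // => /eqP->.
have fiota a g : g \in G -> f (iota a) g = iota (to a g).
  move=> Gg; rewrite -[iota a]divr1 -(rmorph1 iota).
  by rewrite fE ?oner_eq0 // aact1 // rmorph1 divr1.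
have fD x y g : g \in G -> f (x + y) g = f x g + f y g.
  move=> Gg; have [nx ->] := denP x; have [ny ->] := denP y.
  rewrite addf_div ?i0 // -!iM -iD !fE ?nzM //.
  by rewrite (lactD linA) // !aactM // iD !iM addf_div ?nz_to.
have fM x y g : g \in G -> f (x * y) g = f x g * f y g.
  move=> Gg; have [nx ->] := denP x; have [ny ->] := denP y.
  by rewrite mulf_div -!iM !fE ?nzM // !aactM // !iM mulf_div.
have f1 g : g \in G -> f 1 g = 1.
  by move=> Gg; rewrite -(rmorph1 iota) fiota // aact1.
have fZ a x g : g \in G -> f (a *: x) g = a *: f x g.
  move=> Gg; rewrite -mulr_algl fM // -[RHS]mulr_algl; congr (_ * _).
  have -> : a%:A = iota a%:A by rewrite linearZ rmorph1.
  by rewrite fiota // aact_alg.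
have fact : is_action G f.
  split=> [g x y|x g h Gg Gh].
    have [Gg|notGg] := boolP (g \in G); last by rewrite /f (negPf notGg).
    move=> fxy; apply/eqP; rewrite -subr_eq0; apply/eqP; set z := x - y.
    have : f z g = 0 by rewrite /z -scaleN1r fD // fZ // scaleN1r fxy subrr.
    have [nz zE] := denP z; rewrite {1}zE fE // => /eqP.
    rewrite mulf_eq0 invr_eq0 [X in _ || X]negbTE ?nz_to // orbF.
    rewrite {2}zE => n0; rewrite [num z](_ : _ = 0) ?rmorph0 ?mul0r //.
    by apply/eqP; apply: contraLR n0; apply: nz_to.
  have Ggh : (g * h)%g \in G by apply: groupM.
  have [nz xE] := denP x; rewrite {1 2}xE !fE // -?i0 ?nz_to //.
  by rewrite !(actionM to _ (subxx G)).
exists (Action fact); split=> [g Gg|g a Gg] /=; last exact: fiota.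
split; first by move=> a x y; rewrite fD // fZ.
by split; [apply: f1 | move=> x y; apply: fM].
Qed.

End InducedAction.

(** * Separation, independence of automorphisms and traces *)

Section FixedField.
Variables (k : fieldType) (gT : finGroupType) (G : {group gT}).
Variables (K : fieldAlgType k) (toK : action G K).
Hypothesis htoK : acts_by_alg_automorphisms toK.

Let linK g : g \in G -> linear (toK^~ g).
Proof. by case/htoK. Qed.

(* The combination is the expanded product over the h in G outside P of
   l_h^g - l_h^h, where l_h in L is moved by h. *)
Lemma separating_combination (L : set K) (P : {set gT}) :
    GRing.subring_closed [in L] ->
    (forall g l, g \in G -> L l -> L (toK l g)) ->
    (forall g, g \in G -> g \notin P -> exists2 l, L l & toK l g != l) ->
  exists s : seq (K * K),
    [/\ forall u, u \in s -> L u.1 /\ L u.2,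
        \sum_(u <- s) u.1 * u.2 != 0
      & forall g, g \in G -> g \notin P -> \sum_(u <- s) u.1 * toK u.2 g = 0].
Proof.
move=> /subring_closedP[L1 LB LM] LG sepL.
have L0 : L 0 by rewrite -(subrr 1); apply: LB.
have LN x : L x -> L (- x) by move=> Lx; rewrite -sub0r; apply: LB.
suff: forall r : seq gT, (forall g, g \in r -> g \in G /\ g \notin P) ->
  exists s : seq (K * K), [/\ forall u, u \in s -> L u.1 /\ L u.2,
        \sum_(u <- s) u.1 * u.2 != 0
      & forall g, g \in r -> \sum_(u <- s) u.1 * toK u.2 g = 0].
  move=> /(_ (enum (G :\: P))) []; first by move=> g; rewrite mem_enum inE => /andP[].
  move=> s [Ls nz_s s0]; exists s; split=> // g Gg notPg.
  by apply: s0; rewrite mem_enum inE notPg.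
elim=> [|h r IHr] rGP.
  exists [:: (1, 1)]; split=> //.
    by move=> u; rewrite inE => /eqP->.
  by rewrite big_seq1 mulr1 oner_eq0.
have [|s [Ls nz_s s0]] := IHr; first by move=> g rg; apply: rGP; rewrite inE rg orbT.
have [Gh notPh] : h \in G /\ h \notin P by apply: rGP; rewrite inE eqxx.
have [l Ll nz_l] := sepL h Gh notPh.
exists ([seq (u.1, u.2 * l) | u <- s] ++ [seq (- (toK l h * u.1), u.2) | u <- s]).
(* The factor F l - l^h is nonzero for F the identity and zero for F the action of h. *)
have sumE (F : K -> K) : {morph F : x y / x * y} ->
    \sum_(u <- [seq (u.1, u.2 * l) | u <- s] ++ [seq (- (toK l h * u.1), u.2) | u <- s])
      u.1 * F u.2 = (F l - toK l h) * \sum_(u <- s) u.1 * F u.2.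
  move=> FM; rewrite big_cat !big_map /= mulrBl !mulr_sumr -sumrN.
  congr (_ + _); apply: eq_bigr => u _; rewrite /= ?FM; ring.
split=> [u||g].
- rewrite mem_cat => /orP[]/mapP[v /Ls[Lv1 Lv2] ->] /=; split=> //; first exact: LM.
  by apply: LN; apply: LM => //; apply: LG.
- by rewrite (sumE idfun) // mulf_neq0 // subr_eq0 eq_sym.
rewrite inE => /orP[/eqP->|rg].
  by rewrite (sumE (toK^~ h)) ?subrr ?mul0r //; apply: aactM.
have [Gg _] : g \in G /\ g \notin P by apply: rGP; rewrite inE rg orbT.
by rewrite (sumE (toK^~ g)) ?s0 ?mulr0 //; apply: aactM.
Qed.

Hypothesis faithK : acts_faithfully toK.

(** Take a separating combination with L = K and P = {1}. Applying the relation to the second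
    components and summing against the first ones leaves c 1 times a nonzero sum. *)
Lemma Dedekind_independence (c : gT -> K) :
  (forall a, \sum_(g in G) c g * toK a g = 0) -> c 1%g = 0.
Proof.
move=> c0; have [|||s [_ nz_s s0]] := @separating_combination setT [set 1%g].
- by apply/subring_closedP.
- by [].
- move=> g Gg; rewrite inE => /eqP nt_g; apply: contrapT => triv; apply: nt_g.
  apply: faithK => // a; apply: contrapT => /eqP ga; apply: triv; by exists a.
apply/eqP; have : \sum_(u <- s) u.1 * \sum_(g in G) c g * toK u.2 g = 0.
  by rewrite big1 // => u _; rewrite c0 mulr0.
under eq_bigr do rewrite mulr_sumr; rewrite exchange_big /=.
rewrite (bigD1 1%g) //= [X in _ + X]big1.
  rewrite addr0 => /eqP; under eq_bigr do rewrite mulrCA (action1 toK).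
  by rewrite -mulr_sumr mulf_eq0 (negPf nz_s) orbF.
move=> g /andP[Gg nt_g]; under eq_bigr do rewrite mulrCA.
by rewrite -mulr_sumr s0 ?mulr0 // inE.
Qed.

(** Relative trace from P to G: right multiplication by h permutes the right cosets of P, and
    representatives change only by a left factor in P, which fixes y. *)
Lemma rcosets_trace_inv (P : {group gT}) y : P \subset G ->
  invariants toK P y -> invariants toK G (\sum_(C in rcosets P G) toK y (repr C)).
Proof.
move=> sPG Py h Gh; have reprG C : C \in rcosets P G -> repr C \in G.
  by case/rcosetsP=> g Gg ->; have /rcosetP[x Px ->] := mem_repr_rcoset P g;
     rewrite groupM // (mem_subgroup sPG).
rewrite (lact_sum linK) // [RHS](reindex_acts 'Rs _ Gh) ?actsRs_rcosets //=.
apply: eq_bigr => C PC; have GC := reprG C PC.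
rewrite -(actionM toK _ (subxx G)) //.
have [g Gg ->] := rcosetsP PC.
rewrite rcosetE -rcosetM.
have /rcosetP[x Px ->] := mem_repr_rcoset P g.
have /rcosetP[z Pz ->] := mem_repr_rcoset P (g * h).
have [Gx Gz] := (mem_subgroup sPG Px, mem_subgroup sPG Pz); have Ggh := groupM Gg Gh.
rewrite -mulgA (actionM toK y (subxx G) Gx Ggh) (actionM toK y (subxx G) Gz Ggh).
by rewrite (Py x Px) (Py z Pz).
Qed.

(** For a separating combination s, sum u.1 times the relative trace of u.2 x over s; this lies in L
    because traces lie in K^G. Every coset except P contributes 0, and P contributes x times a
    nonzero element of L, by which one divides. *)
Lemma inv_sub_subfield (L : set K) (P : {group gT}) :
    P \subset G -> GRing.subring_closed [in L] -> (forall x, L x -> L x^-1) ->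
    (forall g l, g \in G -> L l -> L (toK l g)) ->
    (forall g, g \in G -> g \notin P -> exists2 l, L l & toK l g != l) ->
    invariants toK G `<=` L ->
    L `<=` invariants toK P ->
  invariants toK P `<=` L.
Proof.
move=> sPG Lcl LV LG sepL sGL sLP x Px.
have /subring_closedP[L1 LB LM] := Lcl.
have L0 : L 0 by rewrite -(subrr 1); apply: LB.
have LD u v : L u -> L v -> L (u + v).
  by move=> Lu Lv; rewrite -[v]opprK; apply: (LB) => //; rewrite -sub0r; apply: LB.
have [s [Ls nz_s s0]] := separating_combination Lcl LG sepL.
have Lsum (F : K * K -> K) : (forall u, u \in s -> L (F u)) -> L (\sum_(u <- s) F u).
  by move=> LF; rewrite big_seq; apply: big_ind.
have reprG C : C \in rcosets P G -> repr C \in G.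
  by case/rcosetsP=> g Gg ->; have /rcosetP[y Py ->] := mem_repr_rcoset P g;
     rewrite groupM // (mem_subgroup sPG).
have : L (\sum_(u <- s) u.1 * \sum_(C in rcosets P G) toK (u.2 * x) (repr C)).
  apply: Lsum => u /Ls[Lu1 Lu2]; apply: LM => //; apply: sGL.
  apply: rcosets_trace_inv => // g Pg; rewrite (aactM htoK) ?(mem_subgroup sPG) //.
  by rewrite Px // (sLP _ Lu2).
under eq_bigr do rewrite mulr_sumr; rewrite exchange_big /=.
rewrite (bigD1 (P : {set gT})) /=; last first.
  by apply/rcosetsP; exists 1%g; rewrite ?rcoset1.
rewrite [X in _ + X]big1 ?addr0 => [|C /andP[PC ntC]].
  rewrite repr_group; under eq_bigr do rewrite (action1 toK) mulrA.
  rewrite -mulr_suml => LFx; set F := \sum_(u <- s) _ in nz_s LFx.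
  have LF : L F by apply: Lsum => u /Ls[]; apply: LM.
  by rewrite -[x](mulKf nz_s); apply: LM => //; apply: LV.
have GC := reprG C PC.
under eq_bigr do rewrite aactM // mulrA.
rewrite -mulr_suml s0 ?mul0r //; apply: contra ntC => PrC.
have [g Gg CE] := rcosetsP PC; have := mem_repr_rcoset P g; rewrite -CE => rC.
by rewrite CE in rC PrC *; rewrite -(rcoset_eqP rC) rcoset_id.
Qed.

End FixedField.

(** * The pointwise stabilizer of the socle of K *)

Section SocleStabilizer.
Variables (k : fieldType) (gT : finGroupType) (G : {group gT}).
Variables (K : fieldAlgType k) (toK : action G K) (p : nat).
Hypotheses (pk : p \in [pchar k]) (htoK : acts_by_alg_automorphisms toK).
Hypothesis faithK : acts_faithfully toK.

Let linK g : g \in G -> linear (toK^~ g).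
Proof. by case/htoK. Qed.

(* For a functional f on a representation and a in K, averaging f against the
   orbit of a gives an equivariant map to K; it is nonzero for a suitable a by
   independence of characters.  So every simple module embeds in K, and an
   element fixing Soc(K) acts trivially on the factors of W > U, hence
   unipotently on W. *)
Lemma socle_trivial_extend n (rG : mx_representation k G n) (U W : 'M[k]_n) x q :
    x \in G -> (forall v, Soc toK G v -> toK v x = v) ->
    prime q -> q != p -> (x ^+ q = 1)%g ->
    mxmodule rG U -> mxmodule rG W -> (U <= W)%MS ->
    (forall M : 'M_n, mxmodule rG M -> (U <= M)%MS -> (M <= W)%MS ->
       (M <= U)%MS \/ (W <= M)%MS) ->
    (forall v : 'rV_n, (v <= U)%MS -> v *m rG x = v) ->
  forall v : 'rV_n, (v <= W)%MS -> v *m rG x = v.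
Proof.
move=> Gx Sx pr_q nqp xq modU modW sUW minW Ux v Wv.
(* The columns of [cokermx U] are functionals that together cut out [U]. Averaging one of them maps
   [W] equivariantly into Soc(K), where x is trivial. *)
have Uf j a (w : 'rV_n) : (w <= W)%MS ->
    \sum_(g in G) (w *m rG g^-1%g *m cokermx U) 0 j *: toK a g
    = \sum_(g in G) (w *m rG x *m rG g^-1%g *m cokermx U) 0 j *: toK a g.
  move=> Ww; pose phi (u : 'rV[k]_n) :=
    \sum_(g in G) (u *m rG g^-1%g *m cokermx U) 0 j *: toK a g.
  have equivphi g u : g \in G -> phi (u *m rG g) = toK (phi u) g.
    move=> Gg; rewrite /phi (lact_sum linK) // [LHS](reindex_acts 'R _ Gg) ?astabsR //=.
    apply: eq_bigr => h Gh; rewrite (lactZ linK) // -(actionM toK _ (subxx G)) //.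
    by rewrite invMg -(mulmxA u) -repr_mxM ?groupM ?groupV // mulKVg.
  have linphi : linear phi.
    move=> b u w'; rewrite /phi scaler_sumr -big_split; apply: eq_bigr => g _ /=.
    by rewrite !mulmxDl -!scalemxAl mxE mxE scalerDl scalerA.
  suff e : phi (w *m rG x) = phi w by exact: esym e.
  rewrite equivphi // Sx //.
  apply: (minimal_module_Soc (subxx G) linK (q := id) _ _ linphi equivphi
    modW _ sUW) => //.
  - by move=> h Gh; exists h.
  move=> u Uu; rewrite /phi big1 // => g Gg; rewrite [X in X *: _](_ : _ = 0) ?scale0r //.
  have : (u *m rG g^-1%g <= U)%MS.
    apply: submx_trans (submxMr _ Uu) _; apply: (mxmoduleP modU).
    by rewrite groupV.
  by rewrite submxE => /eqP->; rewrite mxE.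
have Uvx : (v *m rG x - v <= U)%MS.
  rewrite submxE; apply/eqP/rowP=> j; rewrite [RHS]mxE.
  have c0 a :
      \sum_(g in G) (((v *m rG x - v) *m rG g^-1%g *m cokermx U) 0 j)%:A * toK a g = 0.
    transitivity (\sum_(g in G) ((v *m rG x *m rG g^-1%g *m cokermx U) 0 j *: toK a g
      - (v *m rG g^-1%g *m cokermx U) 0 j *: toK a g)).
      apply: eq_bigr => g Gg; rewrite mulr_algl -scalerBl; congr (_ *: _).
      by rewrite !mulmxBl !mxE.
    by rewrite sumrB -Uf // subrr.
  have /eqP := Dedekind_independence htoK faithK c0.
  by rewrite invg1 repr_mx1 mulmx1 scaler_eq0 oner_eq0 orbF => /eqP.
(* The difference lies in [U], where x is trivial, so powers of x add multiples of it. For i = q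
   this gives q (v x - v) = 0, and q is invertible in k. *)
have vxn i : v *m rG (x ^+ i)%g = v + (v *m rG x - v) *+ i.
  elim: i => [|i IHi]; first by rewrite expg0 repr_mx1 mulmx1 addr0.
  rewrite expgSr repr_mxM ?groupX // mulmxA IHi mulmxDl -scaler_nat -scalemxAl.
  by rewrite (Ux _ Uvx) scaler_nat mulrS addrA [v + _]addrC subrK.
have := vxn q; rewrite xq repr_mx1 mulmx1 -[X in X = _]addr0 => /addrI/esym/eqP.
rewrite -scaler_nat scaler_eq0 => /orP[q0|]; last by rewrite subr_eq0 => /eqP.
have : q \in [pchar k] by rewrite inE pr_q.
by rewrite (pcharf_eq pk) inE (negPf nqp).
Qed.

(* The regular representation is faithful: grow a submodule on which x is
   trivial, one simple factor at a time. *)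
Lemma socle_trivial_p'elt x q :
    x \in G -> (forall v, Soc toK G v -> toK v x = v) ->
    prime q -> q != p -> (x ^+ q = 1)%g ->
  x = 1%g.
Proof.
move=> Gx Sx pr_q nqp xq; pose rG := regular_repr k G.
pose trivial_on (U : 'M[k]_#|G|) :=
  mxmodule rG U /\ forall v : 'rV_#|G|, (v <= U)%MS -> v *m rG x = v.
pose Q r := `[< exists2 U, trivial_on U & \rank U = r >].
have exQ : exists r, Q r.
  exists 0%N; apply/asboolP; exists 0; last exact: mxrank0.
  by split=> [|v]; rewrite ?mxmodule0 // submx0 => /eqP->; rewrite mul0mx.
have Qn r : Q r -> (r <= #|G|)%N by case/asboolP=> U _ <-; apply: rank_leq_row.
case: (ex_maxnP exQ Qn) => r /asboolP[U [modU Ux] rU] rmax.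
pose above (W : 'M[k]_#|G|) := [&& mxmodule rG W, (U <= W)%MS & ~~ (W <= U)%MS].
have [U1|notU1] := boolP (1%:M <= U)%MS.
  have rx1 : rG x = 1%:M.
    by apply/row_matrixP=> i; rewrite rowE Ux ?rowE ?mulmx1 // (submx_trans (submx1 _)).
  apply/set1P/(fintype.subsetP (regular_mx_faithful k G)).
  by apply/rkerP.
(* A submodule of least rank among those properly above [U] has nothing strictly between it and
   [U]. *)
pose P r := `[< exists2 W, above W & \rank W = r >].
have exP : exists r, P r.
  by exists (\rank (1%:M : 'M[k]_#|G|)); apply/asboolP; exists 1%:M;
     rewrite // /above mxmodule1 submx1.
case: (ex_minnP exP) => m /asboolP[W /and3P[modW sUW nsWU] rW] mmin.
have minW (M : 'M_#|G|) : mxmodule rG M -> (U <= M)%MS -> (M <= W)%MS ->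
    (M <= U)%MS \/ (W <= M)%MS.
  move=> modM sUM sMW; have [sMU|nsMU] := boolP (M <= U)%MS; [by left|right].
  rewrite -(mxrank_leqif_sup sMW).2 eqn_leq mxrankS //= rW; apply: mmin.
  by apply/asboolP; exists M; rewrite // /above modM sUM.
have Wx := socle_trivial_extend Gx Sx pr_q nqp xq modU modW sUW minW Ux.
have /rmax : Q (\rank W) by apply/asboolP; exists W.
rewrite -rU => le_rk; case/negP: nsWU.
by rewrite -(mxrank_leqif_sup sUW).2 eqn_leq le_rk mxrankS.
Qed.

(** The stabilizer is normal because the socle is G-stable, and a p-group by Cauchy, since its
    elements of prime order q different from p would be trivial. Hence it lies in ['O_p(G)]. *)
Lemma socle_stabilizer x :
  x \in G -> (forall v, Soc toK G v -> toK v x = v) -> x \in 'O_p(G)%g.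
Proof.
move=> Gx Sx; have [N [sNG NP]] := pointwise_stabilizer toK (Soc toK G).
suff sNp : (N \subset 'O_p(G))%g by apply: mem_subgroup sNp _; apply/NP.
apply: pcore_max.
  apply/pgroupP=> q pr_q /(Cauchy pr_q)[y Ny oy]; rewrite inE.
  apply: contraT => nqp; have Gy := mem_subgroup sNG Ny.
  have y1 : y = 1%g.
    apply: (@socle_trivial_p'elt y q) => //; last by rewrite -oy expg_order.
    by apply/NP.
  by move: pr_q; rewrite -oy y1 order1.
rewrite /normal sNG; apply/normsP=> g Gg; apply/setP=> y.
have /submoduleP[_ _ SG] := submodule_Soc linK (subxx G).
suff NJ h z : h \in G -> z \in N -> (z ^ h)%g \in N.
  rewrite mem_conjg; apply/idP/idP=> [/(NJ g)|Ny]; last by apply: NJ; rewrite ?groupV.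
  by rewrite conjgKV; apply.
move=> Gh Nz; have Gz := mem_subgroup sNG Nz; apply/NP; first by rewrite groupJ.
move=> v Sv; rewrite conjgE !(actionM toK _ (subxx G)) ?groupM ?groupV //.
have [_ ->] := (Gz, (NP z Gz).1 Nz); last by apply: SG; rewrite ?groupV.
by rewrite -(actionM toK _ (subxx G)) ?groupV // mulVg (action1 toK).
Qed.

End SocleStabilizer.

(** * Orbit polynomials and integrality *)

Section OrbitPolynomial.
Variables (k : fieldType) (gT : finGroupType) (G : {group gT}).
Variables (A : comAlgType k) (to : action G A).
Hypothesis hto : acts_by_alg_automorphisms to.

Let linto g : g \in G -> linear (to^~ g).
Proof. by case/hto. Qed.

(** The membership proof is an argument so that ring morphism instances can be attached. *)
Definition act_fun g of g \in G := to^~ g.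

Lemma act_fun_is_zmod_morphism g (Gg : g \in G) : zmod_morphism (act_fun Gg).
Proof. by move=> u v; apply: (lactB linto). Qed.

Lemma act_fun_is_monoid_morphism g (Gg : g \in G) : monoid_morphism (act_fun Gg).
Proof. by case: (hto Gg). Qed.

HB.instance Definition _ g (Gg : g \in G) :=
  GRing.isZmodMorphism.Build A A (act_fun Gg) (act_fun_is_zmod_morphism Gg).
HB.instance Definition _ g (Gg : g \in G) :=
  GRing.isMonoidMorphism.Build A A (act_fun Gg) (act_fun_is_monoid_morphism Gg).

Definition orbit_poly a : {poly A} := \prod_(g in G) ('X - (to a g)%:P).

Lemma orbit_poly_monic a : orbit_poly a \is monic.
Proof. by apply: monic_prod => g _; apply: monicXsubC. Qed.

Lemma orbit_poly_root a : root (orbit_poly a) a.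
Proof.
rewrite /root /orbit_poly horner_prod (bigD1 1%g) //= hornerXsubC.
by rewrite (action1 to) subrr mul0r.
Qed.

(** Acting by h on the coefficients permutes the linear factors. *)
Lemma orbit_poly_inv a i : invariants to G (orbit_poly a)`_i.
Proof.
move=> h Gh; suff pE : map_poly (act_fun Gh) (orbit_poly a) = orbit_poly a.
  by rewrite -[LHS]/(act_fun Gh _) -coef_map pE.
rewrite /orbit_poly rmorph_prod [RHS](reindex_acts 'R _ Gh) ?astabsR //=.
apply: eq_bigr => g Gg; rewrite rmorphB /= map_polyX map_polyC /= /act_fun.
by rewrite (actionM to a (subxx G)).
Qed.

End OrbitPolynomial.

(** Passes from coefficients in a subset of K to polynomials over A: coefficients are lifted through
    [iota], whose injectivity keeps the lift monic. *)
Lemma integral_over_image (k : fieldType) (A : comAlgType k) (K : fieldAlgType k)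
    (iota : {lrmorphism A -> K}) (R : set A) x :
  injective iota -> integral_over (iota @` R) x -> integralOver iota x.
Proof.
move=> inj_iota [q [mon_q Rq qx]].
have /choice[c cE] i : exists a, iota a = q`_i.
  by have /set_mem[a _ aE] := Rq i; exists a.
have qE : map_poly iota (\poly_(i < size q) c i) = q.
  apply/polyP=> i; rewrite coef_map coef_poly /=; case: ltnP => [_|/leq_sizeP q0].
    by rewrite cE.
  by rewrite rmorph0 q0.
exists (\poly_(i < size q) c i); last by rewrite qE.
have nz_q : (0 < size q)%N by rewrite size_poly_gt0 monic_neq0.
have c1 : c (size q).-1 = 1.
  by apply: inj_iota; rewrite cE rmorph1; apply/monicP.
rewrite monicE lead_coefE size_poly_eq ?c1 ?oner_eq0 //.
by rewrite coef_poly prednK // leqnn c1.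
Qed.

(** * The socle algebra of K as a fixed field *)

Section FixedSubfield.
Variables (k : fieldType) (p : nat) (gT : finGroupType) (G : {group gT}).
Variables (K : fieldAlgType k) (toK : action G K).
Hypotheses (pk : p \in [pchar k]) (htoK : acts_by_alg_automorphisms toK).
Hypothesis faithK : acts_faithfully toK.

(** K_soc is a G-stable subfield between K^G and K^P for P = ['O_p(G)], and each element of G
    outside P moves some element of it; the trace argument then gives K^P. *)
Lemma inv_pcore_eq_soc_field : invariants toK 'O_p(G)%G = soc_alg toK G.
Proof.
have sOG : ('O_p(G) \subset G)%g := pcore_sub p G.
have sLP : soc_alg toK G `<=` invariants toK 'O_p(G)%G.
  exact: (soc_alg_sub_inv htoK pk (subxx G) (pcore_normal p G) (pcore_pgroup p G)).
apply/seteqP; split=> //; apply: (inv_sub_subfield htoK) => //.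
- have /subalg_closedP[L1 LL LM] := soc_alg_closed toK G.
  by apply/subring_closedP; split=> // u v Lu Lv; rewrite addrC -scaleN1r; apply: LL.
- exact: (soc_algV htoK).
- by move=> g l Gg; apply: (soc_alg_act htoK).
- move=> g Gg notPg; apply: contrapT => triv; case/negP: notPg.
  apply: (socle_stabilizer pk htoK faithK Gg) => v Sv.
  apply: contrapT => /eqP gv; apply: triv; exists v => //.
  exact: Soc_sub_soc_alg.
exact: (inv_sub_soc_alg htoK).
Qed.

End FixedSubfield.

Theorem proposition5p7 (k : fieldType) (p : nat) (hp : p \in [pchar k])
    (gT : finGroupType) (G : {group gT}) (A : comAlgType k) (to : action G A)
    (hto : acts_by_alg_automorphisms to) (hfaith : acts_faithfully to) :
  [/\ [/\ invariants to G `<=` soc_alg to G,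
          soc_alg to G `<=` invariants to 'O_p(G)%G
        & invariants to 'O_p(G)%G = soc_alg to 'O_{p, p^'}(G)%G],
      GRing.integral_domain_axiom A ->
      forall (K : fieldAlgType k) (iota : {lrmorphism A -> K})
             (toK : action G K),
        is_quotient_field iota -> induced_action iota to toK ->
        Quot (iota @` soc_alg to G) = soc_alg toK G /\
        soc_alg toK G = adjoin (invariants toK G) (iota @` Soc to G)
    & GRing.integral_domain_axiom A ->
      forall (K : fieldAlgType k) (iota : {lrmorphism A -> K}),
        is_quotient_field iota -> normal_domain iota ->
        iota @` invariants to 'O_p(G)%G =
        integral_closure_in (Quot (iota @` soc_alg to G))
                            (iota @` soc_alg to G)].
Proof.
have sOG : ('O_p(G) \subset G)%g := pcore_sub p G.
split.
- split; last exact: inv_pcore_eq_soc_alg.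
    exact: (inv_sub_soc_alg hto).
  exact: (soc_alg_sub_inv hto hp (subxx G) (pcore_normal p G) (pcore_pgroup p G)).
- move=> _ K iota toK quoK htoK; exact: (Quot_soc_alg hto quoK htoK).
move=> _ K iota quoK normA; have [inj_iota _] := quoK.
have [toK htoK] := induced_action_exists hto quoK; have [actK iotaE] := htoK.
have faithK : acts_faithfully toK.
  move=> g Gg triv; apply: hfaith => // a; apply: inj_iota.
  by rewrite -iotaE // triv.
have [-> _] := Quot_soc_alg hto quoK htoK.
rewrite -(inv_pcore_eq_soc_field hp actK faithK).
(* Now Quot(A_soc) is K^P. An element of A^P is a root of its orbit polynomial, whose coefficients
   lie in A^G and so in A_soc. *)
apply/seteqP; split=> [_ [a Pa <-]|x [/set_mem Px intx]].
  split; first by apply/mem_set/(iota_invariants quoK htoK _ sOG).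
  exists (map_poly iota (orbit_poly to a)); split.
  - exact/monic_map/orbit_poly_monic.
  - move=> i; rewrite coef_map; apply/mem_set; exists (orbit_poly to a)`_i => //.
    by apply: (inv_sub_soc_alg hto) => //; apply: orbit_poly_inv.
  - by apply: rmorph_root; apply: orbit_poly_root.
(* Integrality over A_soc gives integrality over A, so normality puts x in A. *)
have [a _ aE] := normA x (integral_over_image inj_iota intx).
by exists a => //; apply/(iota_invariants quoK htoK _ sOG); rewrite ?aE.
Qed.
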